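(* Let $\Omega\subset\mathbb{R}^n$ be a compact state space, let $\mathcal{A}\subseteq\mathbb{R}^m$ be an action space, and consider the deterministic discrete-time system $s_{t+1}=f(s_t,a_t)$ with $f:\Omega\times\mathcal{A}\to\Omega$. Let $s_T\in\Omega$ be the target (equilibrium) state. For a policy $\pi$, write $a_t^{\pi}\in\mathcal{A}$ for the action that $\pi$ selects at state $s_t$. Let $\pi_{old}$ and $\pi_{new}$ be policies. Suppose the following hold. (1) The cost function $c(s,\pi(\cdot\mid s))\ge 0$, with $c(s_T,\pi(\cdot\mid s_T))=0$, is bounded for all $s\in\Omega$ and Lipschitz continuous with respect to $s$: there is $l_c>0$ such that $\Vert c(s_1,\pi(\cdot\mid s_1))-c(s_2,\pi(\cdot\mid s_2))\Vert_2\le l_c\Vert s_1-s_2\Vert_2$ for all $s_1,s_2\in\Omega$ and $\pi\in\{\pi_{old},\pi_{new}\}$. (2) The dynamics $f$ is Lipschitz continuous with respect to the action: there is $l_f>0$ such that $\Vert f(s,a^2)-f(s,a^1)\Vert_2\le l_f\Vert a^2-a^1\Vert_2$ for all $s\in\Omega$ and $a^1,a^2\in\mathcal{A}$. (3) $\pi_{old}$ is a feasible policy with associated Lyapunov function $L_{\pi_{old}}:\Omega\to\mathbb{R}$, and $L_{\pi_{old}}$ is Lipschitz continuous on $\Omega$ with Lipschitz constant $l_L>0$. If for every $s_t\in\Omega$, with $s_{t+1}=f(s_t,a_t^{\pi_{old}})$ (so that $(s_t,a_t^{\pi_{old}},s_{t+1})$ is a transition tuple generated by $\pi_{old}$), $$L_{\pi_{old}}(s_{t+1})+l_L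 l_f\Vert a_t^{\pi_{new}}-a_t^{\pi_{old}}\Vert_2-L_{\pi_{old}}(s_t)\le 0,$$ then $\pi_{new}$ is also a feasible policy, and the system under $\pi_{new}$ is stable around $s_T$.
   Context: Closed-loop system: under a fixed policy $\pi$ the system evolves by $s_{t+1}=f(s_t,a_t^{\pi})$, where $a_t^{\pi}$ is the action selected by $\pi$ at $s_t$, so the closed loop is a map $\Omega\to\Omega$. The state $s_T$ is an equilibrium of the closed loop under $\pi_{old}$, i.e. $f(s_T,a^{\pi_{old}})=s_T$ when $a^{\pi_{old}}$ is the action selected by $\pi_{old}$ at $s_T$. Stability around $s_T$ (in the sense of Lyapunov): trajectories starting near $s_T$ stay near $s_T$ for all time, i.e. for every $\varepsilon>0$ there is $\delta>0$ such that every closed-loop trajectory with $s_0\in\Omega$ and $\Vert s_0-s_T\Vert_2<\delta$ satisfies $\Vert s_t-s_T\Vert_2<\varepsilon$ for all $t\ge 0$. Lyapunov function for a policy $\pi$: a continuous function $L:\Omega\to\mathbb{R}$ such that $L(s_T)=0$, $L(s)>0$ for all $s\in\Omega$ with $s\neq s_T$, and $L(s_{t+1})-L(s_t)\le 0$ for all $s_t\in\Omega$, where $s_{t+1}=f(s_t,a_t^{\pi})$. Feasible policy: a policy $\pi$ under which the closed-loop system is stable around $s_T$ and for which a Lyapunov function exists. *)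

(* Defs.v *)
From HB Require Import structures.
From mathcomp Require Import all_boot all_order all_algebra.
From mathcomp Require Import all_classical all_reals all_analysis.
Set Implicit Arguments.
Unset Strict Implicit.
Unset Printing Implicit Defensive.
Import Order.TTheory GRing.Theory Num.Theory.
Import numFieldNormedType.Exports.
Local Open Scope classical_set_scope.
Local Open Scope ring_scope.

(* The library norm `|x| on row vectors is the sup norm; it induces the same
   topology (hence the same compact sets and continuous functions). *)
Definition norm2 (R : realType) (k : nat) (x : 'rV[R]_k) : R :=
  Num.sqrt (\sum_(i < k) x ord0 i ^+ 2).

(* Probability measures on the Borel sets of R^m. *)
Definition action_law (R : realType) (m : nat) : Type :=
  probability (g_sigma_algebraType (@open 'rV[R]_m)) R.

(* [pol_law pi s] is pi(.|s), a probability distribution on A, which only the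
   cost function looks at; [pol_act pi s] is the action a^pi selected at s,
   which drives the dynamics. The selection rule is left unspecified; for a
   deterministic policy, pi(.|s) is the Dirac measure at the selected action.
   As A need not be Borel, "carried by A" says that A has outer measure 1.
   Values outside Omega are irrelevant. *)
Record policy (R : realType) (n m : nat)
    (Omega : set 'rV[R]_n) (A : set 'rV[R]_m) := Policy {
  pol_law : 'rV[R]_n -> action_law R m ;
  pol_act : 'rV[R]_n -> 'rV[R]_m ;
  pol_lawP : forall s, Omega s ->
    forall B : set (g_sigma_algebraType (@open 'rV[R]_m)),
    measurable B -> A `<=` B -> pol_law s B = 1%E ;
  pol_actP : forall s, Omega s -> A (pol_act s) }.

Section ClosedLoop.
Context (R : realType) (n m : nat).
Context (Omega : set 'rV[R]_n) (A : set 'rV[R]_m).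
Context (f : 'rV[R]_n -> 'rV[R]_m -> 'rV[R]_n) (sT : 'rV[R]_n).
Implicit Types (pi : policy Omega A) (L : 'rV[R]_n -> R).

Definition closed_loop pi (s : 'rV[R]_n) : 'rV[R]_n := f s (pol_act pi s).

Definition trajectory pi (s : nat -> 'rV[R]_n) : Prop :=
  Omega (s 0%N) /\ forall t, s t.+1 = closed_loop pi (s t).

Definition stable pi : Prop :=
  forall eps : R, 0 < eps ->
  exists2 delta : R, 0 < delta &
    forall s, trajectory pi s -> norm2 (s 0%N - sT) < delta ->
      forall t, norm2 (s t - sT) < eps.

Definition lyapunov pi L : Prop :=
  [/\ {within Omega, continuous L},
      L sT = 0,
      forall s, Omega s -> s <> sT -> 0 < L s
    & forall s, Omega s -> L (closed_loop pi s) - L s <= 0].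

Definition feasible pi : Prop := stable pi /\ exists L, lyapunov pi L.

End ClosedLoop.

(* Main.v *)
(* The old Lyapunov function also works for the new policy: by the Lipschitz
   bounds, replacing a^old by a^new in one step raises it by at most
   l_L l_f |a^new - a^old|, which is exactly the slack in the decrease
   condition. Stability then follows from the Lyapunov function alone: by
   compactness it has a positive minimum mu outside the eps-ball around sT, its
   sublevel set below mu is invariant, and by continuity that sublevel set
   contains all states near sT. *)

Require Import Defs.
From HB Require Import structures.
From mathcomp Require Import all_boot all_order all_algebra.
From mathcomp Require Import all_classical all_reals all_analysis.
Import Order.TTheory GRing.Theory Num.Theory.
Import numFieldNormedType.Exports.
Local Open Scope classical_set_scope.
Local Open Scope ring_scope.

(** Serves to show that the complement of a Euclidean ball is closed, although the topology is that
    of the sup norm. *)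
Lemma norm2_continuous (R : realType) (k : nat) :
  continuous (@norm2 R k).
Proof.
move=> x; apply: continuous_comp; last exact: sqrt_continuous.
apply: continuous_big => [|i _ {}x]; first exact: add_continuous.
apply: (@continuous_comp _ _ _ (fun y : 'rV[R]_k => y ord0 i)
  (fun z : R => z ^+ 2)); first exact: coord_continuous.
exact: exprn_continuous.
Qed.

(** The square of one coordinate is a term of a sum of squares. This puts Euclidean balls inside
    sup-norm balls of the same radius. *)
Lemma ler_coord_norm2 (R : realType) (k : nat) (x : 'rV[R]_k) (i : 'I_k) :
  `|x ord0 i| <= norm2 x.
Proof.
rewrite -sqrtr_sqr ler_wsqrtr // (bigD1 i) //= lerDl.
by apply: sumr_ge0 => j _; exact: sqr_ge0.
Qed.

Section LyapunovStability.
Context (R : realType) (n m : nat).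
Context (Omega : set 'rV[R]_n) (A : set 'rV[R]_m).
Context (f : 'rV[R]_n -> 'rV[R]_m -> 'rV[R]_n) (sT : 'rV[R]_n).
Context (compact_Omega : compact Omega).
Context (f_Omega : forall s a, Omega s -> A a -> Omega (f s a)).
Context (sT_Omega : Omega sT).
Implicit Types (pi : policy Omega A) (L : 'rV[R]_n -> R).

Lemma trajectory_Omega pi s : trajectory f pi s -> forall t, Omega (s t).
Proof.
move=> [s0 sS]; elim=> [//|t IH].
by rewrite sS; apply: f_Omega => //; exact: pol_actP.
Qed.

Lemma lyapunov_nonincreasing pi L s :
  lyapunov f sT pi L -> trajectory f pi s -> forall t, L (s t) <= L (s 0%N).
Proof.
move=> [_ _ _ dec] traj; elim=> [//|t]; apply: le_trans.
by rewrite traj.2 -subr_le0; apply: dec; exact: trajectory_Omega _ _ traj t.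
Qed.

Lemma lyapunov_gap pi L (eps : R) : lyapunov f sT pi L -> 0 < eps ->
  exists2 mu : R, 0 < mu &
    forall s, Omega s -> L s < mu -> norm2 (s - sT) < eps.
Proof.
move=> [cL LsT Lpos _] eps0.
pose K := Omega `&` (fun s => norm2 (s - sT)) @^-1` [set x | eps <= x].
have [K0|/set0P/negP/negbNE/eqP K0] := pselect (K !=set0); last first.
  (* If [K] is empty, all of [Omega] lies in the eps-ball, so any positive [mu] will do. *)
  exists 1 => // s Os _; rewrite ltNge; apply/negP => epss.
  by have : K s by []; rewrite K0.
have cK : compact K.
  apply: compact_closedI => //; apply: preimage_closed; last exact: closed_ge.
  move=> s _; apply: continuous_comp; last exact: norm2_continuous.
  by apply: continuousB; [move=> P; exact|exact: cst_continuous].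
have KO : K `<=` Omega by move=> s [].
have [s1 /set_mem[Os1 s1eps] minL] :=
  compact_EVT_min K0 cK (continuous_subspaceW KO cL).
exists (L s1) => [|s Os]; last first.
  rewrite !ltNge; apply: contra => epss.
  by apply: minL; rewrite inE.
(* The minimiser [s1] is not [sT]: it is at distance at least [eps] from it. Hence the minimum is
   positive. *)
apply: Lpos => // s1T; move: s1eps; rewrite /= s1T subrr /norm2.
rewrite big1 ?sqrtr0 => [|i _]; last by rewrite mxE expr0n.
by rewrite leNgt eps0.
Qed.

Lemma lyapunov_stable pi L : lyapunov f sT pi L -> stable f sT pi.
Proof.
move=> lyapL eps eps0.
have [mu mu0 gap] := lyapunov_gap _ _ _ lyapL eps0.
have [cL LsT _ _] := lyapL.
(* [L] is continuous only relative to [Omega], so [d] controls only states of [Omega] near [sT]. *)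
have /cvgrPdist_lt/(_ mu mu0) : L @ within Omega (nbhs sT) --> L sT.
  by move/subspace_continuousP: cL; apply.
rewrite near_withinE => /nbhs_ballP[d /= d0 dL].
exists d => // s traj sd t; have sO := trajectory_Omega _ _ traj.
(* Since [L] never exceeds its initial value, only [L (s 0) < mu] remains. *)
apply: gap => //; apply: le_lt_trans (lyapunov_nonincreasing _ _ _ lyapL traj t) _.
rewrite -[L _]subr0 -LsT; apply: le_lt_trans (ler_norm _) _.
rewrite distrC; apply: (dL (s 0%N)) => //.
(* The library's ball is entrywise; each coordinate is at most the Euclidean norm, hence below
   [d]. *)
split=> // i j; rewrite ord1 -ball_normE /ball_ /= distrC.
by apply: le_lt_trans sd; have := ler_coord_norm2 _ _ (s 0%N - sT) j; rewrite !mxE.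
Qed.

End LyapunovStability.

Theorem theorem1 (R : realType) (n m : nat)
    (Omega : set 'rV[R]_n) (A : set 'rV[R]_m)
    (f : 'rV[R]_n -> 'rV[R]_m -> 'rV[R]_n) (sT : 'rV[R]_n)
    (pi_old pi_new : policy Omega A)
    (c : 'rV[R]_n -> action_law R m -> R)
    (L_old : 'rV[R]_n -> R) (l_c l_f l_L : R)
    (compact_Omega : compact Omega)
    (f_Omega : forall s a, Omega s -> A a -> Omega (f s a))
    (sT_Omega : Omega sT)
    (sT_equilibrium : f sT (pol_act pi_old sT) = sT)
    (c_ge0 : forall pi, pi = pi_old \/ pi = pi_new ->
      forall s, Omega s -> 0 <= c s (pol_law pi s))
    (c_sT : forall pi, pi = pi_old \/ pi = pi_new ->
      c sT (pol_law pi sT) = 0)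
    (c_bounded : forall pi, pi = pi_old \/ pi = pi_new ->
      exists M : R, forall s, Omega s -> `|c s (pol_law pi s)| <= M)
    (l_c_gt0 : 0 < l_c)
    (c_lipschitz : forall pi, pi = pi_old \/ pi = pi_new ->
      forall s1 s2, Omega s1 -> Omega s2 ->
      `|c s1 (pol_law pi s1) - c s2 (pol_law pi s2)| <= l_c * norm2 (s1 - s2))
    (l_f_gt0 : 0 < l_f)
    (f_lipschitz : forall s a1 a2, Omega s -> A a1 -> A a2 ->
      norm2 (f s a2 - f s a1) <= l_f * norm2 (a2 - a1))
    (pi_old_feasible : feasible f sT pi_old)
    (L_old_lyapunov : lyapunov f sT pi_old L_old)
    (l_L_gt0 : 0 < l_L)
    (L_old_lipschitz : forall s1 s2, Omega s1 -> Omega s2 ->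
      `|L_old s1 - L_old s2| <= l_L * norm2 (s1 - s2))
    (decrease : forall s s', Omega s -> s' = f s (pol_act pi_old s) ->
      L_old s' + l_L * l_f * norm2 (pol_act pi_new s - pol_act pi_old s)
        - L_old s <= 0) :
  feasible f sT pi_new /\ stable f sT pi_new.
Proof.
have act_new s : Omega s -> A (pol_act pi_new s) by exact: pol_actP.
have act_old s : Omega s -> A (pol_act pi_old s) by exact: pol_actP.
have lyap_new : lyapunov f sT pi_new L_old.
  have [cL LsT Lpos _] := L_old_lyapunov; split=> // s Os.
  rewrite /closed_loop; set sn := f s (pol_act pi_new s).
  set so := f s (pol_act pi_old s).
  have Lsn : L_old sn - L_old so <=
      l_L * l_f * norm2 (pol_act pi_new s - pol_act pi_old s).
    apply: le_trans (ler_norm _) _.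
    apply: le_trans (L_old_lipschitz _ _ _ _) _; [exact/f_Omega/act_new|exact/f_Omega/act_old|].
    by rewrite -mulrA ler_pM2l //; apply: f_lipschitz => //; [exact: act_old|exact: act_new].
  (* Once [L_old s] cancels, comparison with the decrease condition at [so] is exactly [Lsn]. *)
  apply: le_trans (decrease s so Os erefl).
  by rewrite lerD2r -lerBlDl.
have stable_new : stable f sT pi_new.
  by apply: lyapunov_stable lyap_new.
by split=> //; split=> //; exists L_old.
Qed.
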